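(* Let $\pi$ be a non-empty set of primes and let $G$ be a finitely generated $\pi$-torsion-free two-step nilpotent group such that the group $G/I_\pi(G')$ is torsion-free, where $G'=[G,G]$ is the commutator subgroup of $G$. Then $G$ is geometrically equivalent to its $\pi$-completion $\widehat{G}^\pi$.
   Context: A $\pi$-number is an integer that is a product of powers of primes from $\pi$. A group $G$ is $\pi$-torsion-free if for every $\pi$-number $n$ the equation $x^n=1$ has only the trivial solution in $G$; it is $\pi$-divisible if for every $\pi$-number $n$ and every $a\in G$ the equation $x^n=a$ has a solution in $G$; it is $\pi$-complete if it is both $\pi$-divisible and $\pi$-torsion-free. Two-step nilpotent means $[[G,G],G]=1$. For a subgroup $H$ of a group $G$, the $\pi$-isolator of $H$ in $G$ is $I_\pi(H)=\{g\in G : g^n\in H \text{ for some } \pi\text{-number } n=n(g)\}$; when $G$ is nilpotent this is a subgroup of $G$. The $\pi$-completion $\widehat{G}^\pi$ of a $\pi$-torsion-free nilpotent group $G$ is the minimal $\pi$-complete nilpotent group containing $G$. It exists, is unique up to isomorphism, and is characterized as a $\pi$-complete nilpotent group containing $G$ in which every element $g$ satisfies $g^m\in G$ for some $\pi$-number $m$. It is regarded as an abstract group (only the usual group operations). Geometric equivalence: for a free group $F=F(X)$ on a finite set $X$, a group $G$ and a subset $T\subseteq F$, put $T'_G=\{\varphi\in\mathrm{Hom}(F,G) : T\subseteq \mathrm{Ker}\,\varphi\}$ and $T''_G=\bigcap_{\varphi\in T'_G}\mathrm{Ker}\,\varphi$. Two groups $G_1,G_2$ are geometrically equivalent if $T''_{G_1}=T''_{G_2}$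 for every free group $F$ of finite rank and every subset $T\subseteq F$. *)

(* Defs.v *)
From HB Require Import structures.
From mathcomp Require Import all_boot.
From mathcomp Require Import boolp classical_sets.

Set Implicit Arguments.
Unset Strict Implicit.
Unset Printing Implicit Defensive.

Local Open Scope classical_set_scope.
Local Open Scope group_scope.
Local Open Scope quotient_scope.

Notation "{ 'hom' G -> H }" := (UMagmaMorphism.type G H)
  (at level 0, G at level 98, H at level 99, format "{ 'hom'  G  ->  H }").

Section Subgroups.
Variable G : groupType.
Implicit Types (A B H : set G) (pi : nat_pred).

Definition is_subgroup H : Prop := group_closed (mem H).

Definition generated A : set G := smallest is_subgroup A.

Definition commutator_subgroup A B : set G :=
  generated [set z | exists x y, [/\ A x, B y & z = [~ x, y]]].

Definition derived_subgroup : set G := commutator_subgroup setT setT.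

Fixpoint lower_central H n : set G :=
  if n is m.+1 then commutator_subgroup (lower_central H m) H else H.

Definition nilpotent H : Prop := exists n, lower_central H n = [set 1].

(* [pi.-nat n] contains [0 < n]; [n = 1], the empty product, is a pi-number. *)
Definition pi_torsion_free pi H : Prop :=
  forall n x, pi.-nat n -> H x -> x ^+ n = 1 -> x = 1.

Definition pi_divisible pi H : Prop :=
  forall n a, pi.-nat n -> H a -> exists2 x, H x & x ^+ n = a.

Definition pi_complete pi H : Prop := pi_divisible pi H /\ pi_torsion_free pi H.

Definition isolator pi H : set G := [set g | exists2 n, pi.-nat n & H (g ^+ n)].

End Subgroups.

Arguments derived_subgroup : clear implicits.

Definition torsion_free (G : groupType) : Prop :=
  forall n (x : G), 0 < n -> x ^+ n = 1 -> x = 1.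

Definition finitely_generated (G : groupType) : Prop :=
  exists s : seq G, generated [set x | x \in s] = setT.

Definition two_step_nilpotent (G : groupType) : Prop :=
  commutator_subgroup (derived_subgroup G) setT = [set 1].

Section SubgroupTheory.
Variable G : groupType.
Implicit Types (A B H : set G).

Lemma is_subgroupP H :
  is_subgroup H <-> H 1 /\ forall x y, H x -> H y -> H (x / y).
Proof.
split=> -[H1 HF]; split; rewrite ?inE // in H1 *.
- by move=> x y Hx Hy; have := HF x y; rewrite !inE; apply.
- by move=> x y; rewrite !inE; apply: HF.
Qed.

Lemma subgroup1 H : is_subgroup H -> H 1.
Proof. by case/is_subgroupP. Qed.

Lemma subgroupV H x : is_subgroup H -> H x -> H x^-1.
Proof. by case/is_subgroupP=> H1 HF Hx; rewrite -div1g; apply: HF. Qed.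

Lemma subgroupM H x y : is_subgroup H -> H x -> H y -> H (x * y).
Proof.
move=> sH Hx Hy; rewrite -[y]invgK.
by case/is_subgroupP: (sH) => _; apply => //; apply: subgroupV.
Qed.

Lemma generated_subgroup A : is_subgroup (generated A).
Proof.
apply/is_subgroupP; split=> [M [sM _]|x y Ax Ay M MA].
  exact: subgroup1.
by case/is_subgroupP: (MA.1) => _; apply; [apply: Ax|apply: Ay].
Qed.

Lemma derived_comm x y : derived_subgroup G [~ x, y].
Proof. by apply: sub_gen_smallest; exists x, y. Qed.

End SubgroupTheory.

Record normal_subgroup (G : groupType) := NormalSubgroup {
  normal_carrier : set G;
  normal_is_subgroup : is_subgroup normal_carrier;
  normal_conj : forall x y, normal_carrier x -> normal_carrier (x ^ y)
}.

Section QuotientGroup.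
Variables (G : groupType) (N : normal_subgroup G).
Implicit Types x y z : G.

Definition coset_rel x y : bool := `[< normal_carrier N (x^-1 * y) >].

Lemma coset_rel_refl : reflexive coset_rel.
Proof.
by move=> x; apply/asboolP; rewrite mulVg; exact: subgroup1 (normal_is_subgroup N).
Qed.

Lemma coset_rel_sym : symmetric coset_rel.
Proof.
have imp x y : coset_rel x y -> coset_rel y x.
  move=> /asboolP Nxy; apply/asboolP; rewrite -[y^-1 * x]invgK invgM invgK.
  exact: subgroupV (normal_is_subgroup N) Nxy.
by move=> x y; apply/idP/idP; apply: imp.
Qed.

Lemma coset_rel_trans : transitive coset_rel.
Proof.
move=> y x z /asboolP Nxy /asboolP Nyz; apply/asboolP.
rewrite -[z](mulVKg y) mulgA; exact: subgroupM (normal_is_subgroup N) Nxy Nyz.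
Qed.

Canonical coset_equiv :=
  EquivRel coset_rel coset_rel_refl coset_rel_sym coset_rel_trans.

Definition quotient_group := {eq_quot coset_rel}.
HB.instance Definition _ := EqQuotient.on quotient_group.
HB.instance Definition _ := Choice.on quotient_group.

Definition coset x : quotient_group := \pi_quotient_group x.

Definition coset_one : quotient_group := coset 1.
Definition coset_mul (a b : quotient_group) : quotient_group :=
  coset (repr a * repr b).
Definition coset_inv (a : quotient_group) : quotient_group :=
  coset (repr a)^-1.

Lemma coset_eqP x y : coset x = coset y <-> normal_carrier N (x^-1 * y).
Proof.
split=> [/eqP|Nxy]; first by rewrite /coset eqmodE => /asboolP.
by apply/eqP; rewrite /coset eqmodE; apply/asboolP.
Qed.

Lemma repr_coset x : normal_carrier N ((repr (coset x))^-1 * x).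
Proof. by apply/coset_eqP; rewrite /coset reprK. Qed.

Lemma coset_mulE x y : coset_mul (coset x) (coset y) = coset (x * y).
Proof.
apply/coset_eqP; set x' := repr (coset x); set y' := repr (coset y).
have -> : (x' * y')^-1 * (x * y) = (x'^-1 * x) ^ y' * (y'^-1 * y).
  by rewrite conjgE invgM !mulgA mulgK.
apply: (subgroupM (normal_is_subgroup N)); last exact: repr_coset.
by apply: normal_conj; apply: repr_coset.
Qed.

Lemma coset_invE x : coset_inv (coset x) = coset x^-1.
Proof.
apply/coset_eqP; set x' := repr (coset x); rewrite invgK.
have -> : x' * x^-1 = ((x'^-1 * x)^-1) ^ x'^-1.
  by rewrite conjgE invgM !invgK !mulgA mulgK.
apply: normal_conj; apply: subgroupV (normal_is_subgroup N) _.
exact: repr_coset.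
Qed.

Lemma coset_surj (a : quotient_group) : exists x, a = coset x.
Proof. by exists (repr a); rewrite /coset reprK. Qed.

Lemma coset_mulA : associative coset_mul.
Proof.
move=> a b c; have [x ->] := coset_surj a; have [y ->] := coset_surj b.
by have [z ->] := coset_surj c; rewrite !coset_mulE mulgA.
Qed.

Lemma coset_mul1 : left_id coset_one coset_mul.
Proof. by move=> a; have [x ->] := coset_surj a; rewrite coset_mulE mul1g. Qed.

Lemma coset_mulg1 : right_id coset_one coset_mul.
Proof. by move=> a; have [x ->] := coset_surj a; rewrite coset_mulE mulg1. Qed.

Lemma coset_mulV : left_inverse coset_one coset_inv coset_mul.
Proof.
move=> a; have [x ->] := coset_surj a.
by rewrite coset_invE coset_mulE mulVg.
Qed.

Lemma coset_mulgV : right_inverse coset_one coset_inv coset_mul.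
Proof.
move=> a; have [x ->] := coset_surj a.
by rewrite coset_invE coset_mulE mulgV.
Qed.

HB.instance Definition _ := isGroup.Build quotient_group
  coset_mulA coset_mul1 coset_mulg1 coset_mulV coset_mulgV.

Lemma coset_is_morphism : monoid_morphism coset.
Proof. by split=> // x y; rewrite -coset_mulE. Qed.

HB.instance Definition _ :=
  isUMagmaMorphism.Build G quotient_group coset coset_is_morphism.

Lemma coset_eq1 x : coset x = 1 <-> normal_carrier N x.
Proof.
split=> [e|Nx]; last first.
  by apply/esym/(coset_eqP 1); rewrite invg1 mul1g.
by move/esym: e => /(coset_eqP 1); rewrite invg1 mul1g.
Qed.

End QuotientGroup.

Section IsolatorOfDerived.
Variables (G : groupType) (pi : nat_pred).

Lemma conj_derived (x y : G) :
  derived_subgroup G x -> derived_subgroup G (x ^ y).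
Proof.
move=> Dx; rewrite -(mulVKg x (x ^ y)) -commgEl.
exact: subgroupM (generated_subgroup _) Dx (derived_comm x y).
Qed.

Definition derived_normal : normal_subgroup G :=
  NormalSubgroup (generated_subgroup _) conj_derived.

Let Q := quotient_group derived_normal.

Lemma abelianization_comm (a b : Q) : commute a b.
Proof.
have [x ->] := coset_surj a; have [y ->] := coset_surj b.
apply/commgP/eqP; rewrite -gmulfR; apply/coset_eq1; exact: derived_comm.
Qed.

Lemma isolator_derivedP (g : G) :
  isolator pi (derived_subgroup G) g <->
  exists2 n, pi.-nat n & (coset derived_normal g) ^+ n = 1.
Proof.
split=> -[n pin h]; exists n => //.
  by rewrite -gmulfXn; apply/(coset_eq1 derived_normal).
by apply/(coset_eq1 derived_normal); rewrite gmulfXn.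
Qed.

Lemma isolator_derived_subgroup :
  is_subgroup (isolator pi (derived_subgroup G)).
Proof.
apply/is_subgroupP; split; first by exists 1%N => //; exact: subgroup1 (generated_subgroup _).
move=> x y /isolator_derivedP[m pim xm] /isolator_derivedP[n pin yn].
apply/isolator_derivedP; exists (m * n)%N; first by rewrite pnatM pim.
rewrite gmulfF expgnFl; last exact: abelianization_comm.
by rewrite expgnA xm expg1n mulnC expgnA yn expg1n divgg.
Qed.

Lemma isolator_derived_conj (x y : G) :
  isolator pi (derived_subgroup G) x ->
  isolator pi (derived_subgroup G) (x ^ y).
Proof. by case=> n pin Dx; exists n; rewrite // -conjXg; apply: conj_derived. Qed.

Definition isolator_derived : normal_subgroup G :=
  NormalSubgroup isolator_derived_subgroup isolator_derived_conj.

End IsolatorOfDerived.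

(* [i] exhibits [C] as a minimal pi-complete nilpotent group containing a copy
   of [G]. *)
Definition is_pi_completion (pi : nat_pred) (G C : groupType)
    (i : {hom G -> C}) : Prop :=
  [/\ injective i,
      nilpotent [set: C],
      pi_complete pi [set: C] &
      forall H : set C, is_subgroup H -> range i `<=` H ->
        nilpotent H -> pi_complete pi H -> H = setT].

(* Universal property of the free group [F] with basis [iota : X -> F]. *)
Definition is_free_group (X : Type) (F : groupType) (iota : X -> F) : Prop :=
  forall (H : groupType) (f : X -> H),
    exists2 phi : {hom F -> H}, phi \o iota =1 f &
      forall psi : {hom F -> H}, psi \o iota =1 f -> psi =1 phi.

Section GeometricEquivalence.
Variables F G : groupType.

Definition ker (phi : {hom F -> G}) : set F := [set w | phi w = 1].

Definition hom_killing (T : set F) : set {hom F -> G} :=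
  [set phi | T `<=` ker phi].

Definition geom_closure (T : set F) : set F :=
  \bigcap_(phi in hom_killing T) ker phi.

End GeometricEquivalence.

Definition geometrically_equivalent (G1 G2 : groupType) : Prop :=
  forall (X : finType) (F : groupType) (iota : X -> F),
    is_free_group iota ->
    forall T : set F, geom_closure G1 T = geom_closure G2 T.

(* Main.v *)
(** Nilpotent pi-torsion-free groups have unique pi-roots, so minimality of the
    completion C forces C to be two-step nilpotent and every element of C to
    have a pi-power in G.  The torsion-free finitely generated abelian group
    G/I_pi(G') has a basis x_1, ..., x_d; hence every element of C is uniquely
    u_1 ... u_d z, with u_j in the isolator of <x_j> and z in the (central)
    isolator of G'.  As commutators are bilinear, the map
      delta_m : u_1 ... u_d z |-> u_1^m ... u_d^m z^(m^2)
    is an endomorphism of C, injective when m is a pi-number, and it maps a given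
    finite subset of C into G when m is divisible by enough pi-numbers.  So every
    homomorphism phi from a free group of finite rank to C yields
    delta_m o phi, with values in G and the same kernel. *)
Require Import Defs.
From HB Require Import structures.
From mathcomp Require Import all_boot.
From mathcomp Require Import boolp classical_sets.

Set Implicit Arguments.
Unset Strict Implicit.
Unset Printing Implicit Defensive.

Local Open Scope classical_set_scope.
Local Open Scope group_scope.

(** * Subgroups, isolators and centralizers *)

Section Subgroups.
Variable G : groupType.
Implicit Types (A B H K : set G) (x y z : G).

Lemma subgroup_intro H : H 1 -> (forall x y, H x -> H y -> H (x * y)) ->
  (forall x, H x -> H x^-1) -> is_subgroup H.
Proof. by move=> H1 HM HV; apply/is_subgroupP; split=> // x y Hx Hy; auto. Qed.

Lemma subgroupX H n x : is_subgroup H -> H x -> H (x ^+ n).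
Proof.
move=> sH Hx; elim: n => [|n IH]; first exact: subgroup1.
by rewrite expgS; apply: subgroupM.
Qed.

Lemma subgroupR H x y : is_subgroup H -> H x -> H y -> H [~ x, y].
Proof.
move=> sH Hx Hy; have [Vx Vy] := (subgroupV sH Hx, subgroupV sH Hy).
by do !apply: subgroupM.
Qed.

Lemma generated_sub A H : is_subgroup H -> A `<=` H -> generated A `<=` H.
Proof. exact: smallest_sub. Qed.

Lemma mem_generated A x : A x -> generated A x.
Proof. exact: sub_gen_smallest. Qed.

Lemma generated1P x y :
  generated [set x] y -> exists k, y = x ^+ k \/ y = x ^- k.
Proof.
(* Quotients of natural powers are closed under products and inverses without any case distinction
   on signs. *)
move=> gy; suff [j [k ->]] : exists j k, y = x ^+ j / x ^+ k.
  case: (leqP k j) => [le_kj|/ltnW le_jk].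
    by exists (j - k)%N; left; rewrite expgnFr.
  by exists (k - j)%N; right; rewrite expgnFr // invgF.
have comm j k : commute (x ^+ j) (x ^+ k)^-1.
  by apply/commuteV/commuteX2/commute_refl.
apply: (@generated_sub [set x] [set y | exists j k, y = x ^+ j / x ^+ k]) gy.
- apply: subgroup_intro; first by exists 0%N, 0%N; rewrite divgg.
  + move=> _ _ [j [k ->]] [j' [k' ->]]; exists (j + j')%N, (k' + k)%N.
    by rewrite !expgnDr invgM -!mulgA; congr (_ * _); rewrite mulgA -comm mulgA.
  + by move=> _ [j [k ->]]; exists k, j; rewrite invgF.
- by move=> _ ->; exists 1%N, 0%N; rewrite divg1.
Qed.

Lemma isolator_ext (pi : nat_pred) H x : H x -> isolator pi H x.
Proof. by exists 1%N. Qed.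

Lemma isolator_root_closed (pi : nat_pred) H n x :
  pi.-nat n -> isolator pi H (x ^+ n) -> isolator pi H x.
Proof.
by move=> pin [m pim Hx]; exists (n * m)%N; rewrite ?pnatM ?pin // expgnA.
Qed.

Definition centralizer A : set G := [set x | forall y, A y -> commute x y].

Lemma centralizer_subgroup A : is_subgroup (centralizer A).
Proof.
apply: subgroup_intro.
- by move=> x Ax; exact/commute_sym/commute1.
- move=> x y Cx Cy z Az.
  by apply/commute_sym/commuteM; apply/commute_sym; [exact: Cx|exact: Cy].
- by move=> x Cx z Az; apply/commute_sym/commuteV/commute_sym/Cx.
Qed.

Lemma lower_central_sub H n : lower_central H n `<=` lower_central setT n.
Proof.
elim: n => [//|n IH] /=; apply: generated_sub; first exact: generated_subgroup.
by move=> _ [x [y [Hx Hy ->]]]; apply: mem_generated; exists x, y; split; auto.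
Qed.

Lemma nilpotent_subgroup H :
  is_subgroup H -> nilpotent [set: G] -> nilpotent H.
Proof.
move=> sH [n nG]; exists n; rewrite eqEsubset; split.
  by rewrite -nG; apply: lower_central_sub.
move=> _ ->; case: n {nG} => [|n]; first exact: subgroup1.
exact: subgroup1 (generated_subgroup _).
Qed.

Lemma conjg_iter x y z n :
  x ^ y = x * z -> commute y z -> x ^ (y ^+ n) = x * z ^+ n.
Proof.
move=> e cyz; elim: n => [|n IH]; first by rewrite conjg1 mulg1.
have cy : commute z y by exact: commute_sym.
by rewrite expgS conjgM e conjMg IH -mulgA [z ^ _]conjgE
  (commuteX _ cy) mulKg expgSr.
Qed.

End Subgroups.

(** * Uniqueness of roots in nilpotent [pi]-torsion-free groups *)

Section NilpotentRoots.
Variables (pi : nat_pred) (G : groupType).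
Hypotheses (nilG : nilpotent [set: G]) (tfG : pi_torsion_free pi [set: G]).
Implicit Types (x y : G) (n : nat).

(* With u_0 = y and u_(k+1) = [u_k, x], the last nontrivial u_k with k > 0 has
   u_k ^ n = [u_(k-1), x ^ n] = 1. *)
Lemma commute_root n x y : pi.-nat n -> commute (x ^+ n) y -> commute x y.
Proof.
move=> pin cxny; pose u := fix u k := if k is k'.+1 then [~ u k', x] else y.
have uS k : u k.+1 = [~ u k, x] by [].
have u_lc k : lower_central setT k (u k).
  by elim: k => [//|k IH]; apply: mem_generated; exists (u k), x.
have cu k : commute (x ^+ n) (u k).
  elim: k => [//|k IH]; rewrite uS; apply: commuteM; first exact: commuteV.
  have cxx : commute (x ^+ n) x by apply/commute_sym/commuteX/commute_refl.
  by apply: commuteM; [exact: commuteV | apply: commuteM].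
have step k : u k.+2 = 1 -> u k.+1 = 1.
  move=> /eqP; rewrite uS => /commgP cukx.
  have e : u k ^ x = u k * u k.+1 by rewrite uS commgEl mulVKg.
  have := conjg_iter n e (commute_sym cukx).
  rewrite conjgE (commute_sym (cu k)) mulKg => /esym/eqP.
  rewrite -[eqbRHS]mulg1 (inj_eq (@mulgI _ _)) => /eqP.
  exact: tfG.
have [c nc] := nilG.
have : u c.+1 = 1.
  have : u c = 1 by have := u_lc c; rewrite nc.
  by rewrite uS => ->; rewrite comm1g.
by elim: c {nc} => [|c IH] uc; [apply/commute_sym/commgP/eqP | exact/IH/step].
Qed.

(** [y] commutes with its own power [x ^+ n], hence with [x]; then [x / y] has trivial [n]-th
    power. *)
Lemma root_inj n x y : pi.-nat n -> x ^+ n = y ^+ n -> x = y.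
Proof.
move=> pin e; have cxy : commute x y.
  by apply: (commute_root pin); rewrite e; apply/commute_sym/commuteX/commute_refl.
by apply: divg1_eq; apply: (tfG pin) => //; rewrite expgnFl // e divgg.
Qed.

Lemma centralizer_root_closed (A : set G) n x :
  pi.-nat n -> centralizer A (x ^+ n) -> centralizer A x.
Proof. by move=> pin cx y Ay; apply: (commute_root pin); apply: cx. Qed.

End NilpotentRoots.

(** * Two-step nilpotency passes from a set to its closure under products, inverses and roots *)

Section MinimalRootClosed.
Variables (pi : nat_pred) (C : groupType) (S : set C).
Hypotheses (nilC : nilpotent [set: C]) (compC : pi_complete pi [set: C]).
Hypothesis min_S : forall H, is_subgroup H -> S `<=` H ->
  (forall n x, pi.-nat n -> H (x ^+ n) -> H x) -> H = setT.
Hypothesis two_step_S :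
  forall x y z, S x -> S y -> S z -> commute [~ x, y] z.
Implicit Types c d : C.

Let tfC : pi_torsion_free pi [set: C] := compC.2.
Let center : set C := centralizer setT.

(** The double centralizer of [S] is a root-closed subgroup containing [S], so it is all of [C]. *)
Lemma centralizer_center : centralizer S `<=` center.
Proof.
have bicent : centralizer (centralizer S) = setT.
  apply: min_S; first exact: centralizer_subgroup.
    by move=> s Ss c Cc; apply/commute_sym/Cc.
  move=> n x; exact: centralizer_root_closed.
move=> c Cc d _; apply/commute_sym.
have Bd : centralizer (centralizer S) d by rewrite bicent.
exact: Bd.
Qed.

(** For fixed [t], the elements that conjugation by [t] changes by a central factor form a
    root-closed subgroup. *)
Lemma central_conj_extend (T : set C) :
  (forall s t, S s -> T t -> center [~ s, t]) ->
  forall c t, T t -> center [~ c, t].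
Proof.
move=> ST c t Tt; have sZ : is_subgroup center by exact: centralizer_subgroup.
pose H := [set c | exists2 z, center z & c ^ t = c * z].
suff HT : H = setT.
  have [z Zz e] : H c by rewrite HT.
  by rewrite commgEl e mulKg.
apply: min_S.
- apply: subgroup_intro.
  + by exists 1; [exact: subgroup1 sZ | rewrite conj1g mulg1].
  + move=> x y [z Zz ex] [z' Zz' ey]; exists (z * z'); first exact: subgroupM sZ _ _.
    by rewrite conjMg ex ey -!mulgA; congr (_ * _); rewrite !mulgA Zz.
  + move=> x [z Zz ex]; exists z^-1; first exact: subgroupV sZ _.
    rewrite conjVg ex invgM; exact: (subgroupV sZ Zz).
- by move=> s Ss; exists [~ s, t]; [exact: ST | rewrite commgEl mulVKg].
(* The [n]-th root [w] of the central factor is again central, so [x ^ t] and [x * w] have the same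
   [n]-th power and coincide. *)
- move=> n x pin [z Zz ex]; have [w _ wz] := compC.1 n z pin I.
  have Zw : center w.
    by apply: (centralizer_root_closed nilC tfC pin); rewrite wz.
  exists w => //; apply: (root_inj nilC tfC pin).
  by rewrite -conjXg ex expgMn ?wz //; apply/commute_sym/Zw.
Qed.

(** The arguments are freed from [S] one at a time; inverting the commutator swaps their roles. *)
Lemma commg_central c d e : commute [~ c, d] e.
Proof.
have SS s t : S s -> S t -> center [~ s, t].
  by move=> Ss St; apply: centralizer_center => z; apply: two_step_S.
have SC s t : S s -> setT t -> center [~ s, t].
  move=> Ss _; rewrite -invgR; apply: (subgroupV (centralizer_subgroup _)).
  exact: (central_conj_extend SS).
exact: (central_conj_extend SC).
Qed.

End MinimalRootClosed.

(** * Commutator calculus in two-step nilpotent groups *)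

Lemma dvdn_bin2_cube n : n * n %| 'C(n ^ 3, 2).
Proof.
have e : (2 * 'C(n ^ 3, 2) = n * n * n * (n ^ 3).-1)%N.
  by rewrite -mul_bin_diag bin1 !expnS expn0 muln1 mulnA.
have [on|en] := boolP (odd n).
  have co : coprime (n * n) 2 by rewrite coprimen2 oddM on.
  by rewrite -(Gauss_dvdr _ co) e -mulnA dvdn_mulr.
have /dvdnP[k nk] : 2 %| n by rewrite dvdn2.
have /eqP : (2 * 'C(n ^ 3, 2) = 2 * (n * n * (k * (n ^ 3).-1)))%N.
  by rewrite e {3}nk !mulnA; congr (_ * _)%N; rewrite mulnC !mulnA.
by rewrite eqn_pmul2l // => /eqP ->; rewrite dvdn_mulr.
Qed.

Section TwoStep.
Variable G : groupType.
Hypothesis commgC3 : forall x y z : G, commute [~ x, y] z.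
Implicit Types (x y z : G) (K : set G).

Lemma commMg x y z : [~ x * y, z] = [~ x, z] * [~ y, z].
Proof.
rewrite [LHS]commgEl conjMg invgM -mulgA [x^-1 * _]mulgA -commgEl.
by rewrite mulgA -(commgC3 x z) -mulgA -commgEl.
Qed.

Lemma commgM x y z : [~ x, y * z] = [~ x, y] * [~ x, z].
Proof. by rewrite -invgR commMg invgM !invgR commgC3. Qed.

Lemma commXg x y n : [~ x ^+ n, y] = [~ x, y] ^+ n.
Proof.
by elim: n => [|n IH]; rewrite ?expg0 ?comm1g // !expgS commMg IH.
Qed.

Lemma commgX x y n : [~ x, y ^+ n] = [~ x, y] ^+ n.
Proof.
by elim: n => [|n IH]; rewrite ?expg0 ?commg1 // !expgS commgM IH.
Qed.

(** Moving [y] past [x ^+ n] costs [[~ y, x] ^+ n], which matches Pascal's rule for the binomial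
    coefficient. *)
Lemma expMg_bin x y n :
  (x * y) ^+ n = x ^+ n * y ^+ n * [~ y, x] ^+ 'C(n, 2).
Proof.
elim: n => [|n IH]; first by rewrite !expg0 !mulg1.
have cz z : commute ([~ y, x] ^+ n) z by apply/commute_sym/commuteX/commute_sym.
rewrite expgS IH binS bin1 addnC expgnDr !mulgA; congr (_ * _).
rewrite !expgS -(mulgA x y) (commgC y) commgX !mulgA.
by rewrite -[LHS]mulgA cz !mulgA.
Qed.

Lemma isolator_subgroup (pi : nat_pred) K :
  is_subgroup K -> is_subgroup (isolator pi K).
Proof.
move=> sK; apply: subgroup_intro.
- by apply: isolator_ext; exact: subgroup1.
- move=> x y [m pim Kx] [k pik Ky]; pose n := (m * k)%N.
  have pin : pi.-nat n by rewrite pnatM pim.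
  have Kxn : K (x ^+ n) by rewrite expgnA; apply: subgroupX.
  have Kyn : K (y ^+ n) by rewrite /n mulnC expgnA; apply: subgroupX.
  (* The commutator term must be a power of [[~ y ^+ n, x ^+ n]], so [n * n] has to divide the
     binomial coefficient. The exponent [n ^ 2] fails for even [n]; the third factor absorbs the
     division by 2. *)
  clearbody n; exists (n ^ 3)%N; first by rewrite pnatX pin.
  have /dvdnP[q qE] := dvdn_bin2_cube n; rewrite expMg_bin qE.
  apply: subgroupM => //.
    by rewrite expnS !expgnA; apply: subgroupM => //; do !apply: subgroupX => //.
  rewrite mulnC !expgnA -commXg -commgX; apply: subgroupX => //.
  exact: subgroupR.
- by move=> x [m pim Kx]; exists m; rewrite // expVgn; apply: subgroupV.
Qed.

End TwoStep.

(** * Bases of finitely generated torsion-free abelian groups *)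

Section AbelianBasis.
Variable A : groupType.
Hypotheses (abA : forall x y : A, commute x y) (tfA : torsion_free A).
Implicit Types (x y : A) (s : seq A) (p : seq (nat * A)).

Definition span s : set A := generated [set x | x \in s].

(** Triangular form of linear independence: each entry has infinite order modulo the span of the
    later ones. Natural exponents suffice because spans are closed under inverses. *)
Fixpoint independent s : Prop :=
  if s is x :: s' then (forall k, span s' (x ^+ k) -> k = 0%N) /\ independent s'
  else True.

Lemma span_subgroup s : is_subgroup (span s).
Proof. exact: generated_subgroup. Qed.

Lemma mem_span s x : x \in s -> span s x.
Proof. by move=> sx; apply: mem_generated. Qed.

Lemma span_sub s (H : set A) :
  is_subgroup H -> {in s, forall x, H x} -> span s `<=` H.
Proof. by move=> sH sub; apply: generated_sub. Qed.

Lemma span_subseq s s' : {subset s <= s'} -> span s `<=` span s'.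
Proof.
by move=> sub; apply: span_sub (span_subgroup _) _ => x /sub /mem_span.
Qed.

Lemma span_nil y : span [::] y -> y = 1.
Proof.
apply: (span_sub (H := [set 1])) => //.
by apply: subgroup_intro => // [_ _ -> ->|_ ->]; rewrite ?mulg1 ?invg1.
Qed.

Lemma span_cons x s y : span (x :: s) y ->
  exists u v, [/\ generated [set x] u, span s v & y = u * v].
Proof.
have [sx ss] := (generated_subgroup [set x], span_subgroup s).
pose H := [set y | exists u v, [/\ generated [set x] u, span s v & y = u * v]].
suff sub : span (x :: s) `<=` H by exact: sub.
apply: span_sub.
- apply: subgroup_intro.
  + by exists 1, 1; split; rewrite ?mulg1 //; [exact: subgroup1 sx|exact: subgroup1 ss].
  + move=> _ _ [u [v [xu sv ->]]] [u' [v' [xu' sv' ->]]].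
    exists (u * u'), (v * v'); split; [exact: subgroupM sx _ _|exact: subgroupM ss _ _|].
    by rewrite -!mulgA; congr (_ * _); rewrite !mulgA (abA v).
  + move=> _ [u [v [xu sv ->]]]; exists u^-1, v^-1.
    by split; [exact: subgroupV sx _|exact: subgroupV ss _|rewrite abA invgM].
- move=> z; rewrite inE => /orP[/eqP ->|sz].
    by exists x, 1; split; [exact: mem_generated|exact: subgroup1 ss|rewrite mulg1].
  by exists 1, z; split; [exact: subgroup1 sx|exact: mem_span|rewrite mul1g].
Qed.

Definition monomial p : A := foldr (fun q acc => q.2 ^+ q.1 * acc) 1 p.

Lemma monomial_cat p p' : monomial (p ++ p') = monomial p * monomial p'.
Proof. by elim: p => [|q p IH] /=; rewrite ?mul1g // IH mulgA. Qed.

(** Exponents become natural numbers by inverting the generators that occur with negative exponent;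
    this changes neither their number nor their span. *)
Lemma span_monomial s y : span s y -> exists p,
  [/\ size p = size s, span s `<=` span (unzip2 p) & y = monomial p].
Proof.
elim: s y => [|x s IH] y.
  by move=> /span_nil ->; exists [::]; split.
move=> /span_cons[u [v [/generated1P[k uE] /IH[p [sp sub vE]] ->]]].
have [x' ux' xx'] : exists2 x', u = x' ^+ k & span (x' :: unzip2 p) x.
  case: uE => ->; [exists x => //|exists x^-1; first by rewrite expVgn].
    by apply: mem_span; rewrite mem_head.
  rewrite -[X in span _ X]invgK; apply: (subgroupV (span_subgroup _)).
  by apply: mem_span; rewrite mem_head.
exists ((k, x') :: p); split=> /=; first by rewrite sp.
  apply: (span_sub (span_subgroup _)) => z; rewrite inE => /orP[/eqP -> //|sz].
  have sub' : span (unzip2 p) `<=` span (x' :: unzip2 p).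
    by apply: span_subseq => t tp; rewrite inE tp orbT.
  exact: (sub' _ (sub _ (mem_span sz))).
by rewrite ux' vE.
Qed.

(* The subtractive Euclidean algorithm on the exponents: x ^ a * y ^ b equals
   (x * y) ^ a * y ^ (b - a) or x ^ (a - b) * (x * y) ^ b. *)
Lemma relation_reduce a x p : (0 < a)%N -> x ^+ a * monomial p = 1 ->
  exists2 s, size s = size p & span (x :: unzip2 p) `<=` span s.
Proof.
(* The sum of the exponents decreases. Once all exponents in [p] are zero, torsion-freeness turns
   [x ^+ a = 1] into [x = 1], and this generator is dropped. *)
have [N leN] := ubnP (a + sumn (unzip1 p)); elim: N => // N IH in a x p leN *.
move=> a_gt0 rel; have [|] := boolP (has (fun q => 0 < q.1)%N p); last first.
  move=> p0; exists (unzip2 p); first by rewrite size_map.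
  have {}p0 : monomial p = 1.
    elim: p p0 {IH leN rel} => //= -[[|b] y] p IHp //=.
    by rewrite expg0 mul1g.
  have x1 : x = 1 by apply: (tfA a_gt0); rewrite -[LHS]mulg1 -[X in _ * X]p0.
  apply: (span_sub (span_subgroup _)) => z; rewrite inE => /orP[/eqP ->|].
    by rewrite x1; exact: subgroup1 (span_subgroup _).
  exact: mem_span.
move=> hasp; case/split_find: hasp leN rel => -[b y] p1 p2 /= b_gt0 _.
rewrite cat_rcons => leN rel.
have monE c z :
    monomial (p1 ++ (c, z) :: p2) = z ^+ c * monomial (p1 ++ p2).
  by rewrite !monomial_cat /= mulgA (abA _ (z ^+ c)) -mulgA.
have szp (q : nat * A) : size (p1 ++ q :: p2) = size (p1 ++ (b, y) :: p2).
  by rewrite !size_cat.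
have sumE q : (sumn (unzip1 (p1 ++ q :: p2)) =
    q.1 + (sumn (unzip1 p1) + sumn (unzip1 p2)))%N.
  by rewrite /unzip1 map_cat sumn_cat /= addnCA.
rewrite monE mulgA in rel; rewrite !sumE in leN.
have spanP (x' y' : A) (q : nat * A) : q.2 = y' -> span [:: x'; y'] x ->
    span [:: x'; y'] y ->
  span (x :: unzip2 (p1 ++ (b, y) :: p2)) `<=`
  span (x' :: unzip2 (p1 ++ q :: p2)).
  move=> qy sx sy; have sub2 : span [:: x'; y'] `<=`
      span (x' :: unzip2 (p1 ++ q :: p2)).
    apply: span_subseq => t; rewrite /unzip2 map_cat !inE mem_cat /= inE qy.
    by case/orP=> ->; rewrite ?orbT.
  apply: (span_sub (span_subgroup _)) => t.
  rewrite /unzip2 map_cat !inE mem_cat /= inE.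
  case/or4P=> [/eqP ->|tp1|/eqP ->|tp2]; try exact: sub2.
    by apply: mem_span; rewrite inE /unzip2 map_cat mem_cat tp1 orbT.
  by apply: mem_span; rewrite inE /unzip2 map_cat mem_cat /= inE tp2 !orbT.
have in2 (u v : A) : span [:: u; v] u /\ span [:: u; v] v.
  by split; apply: mem_span; rewrite !inE eqxx ?orbT.
have sgp (u v : A) := span_subgroup [:: u; v].
have [ltba|leab] := ltnP b a.
  have [|||s sz sub] := IH (a - b)%N x (p1 ++ (b, x * y) :: p2).
  - rewrite sumE /=; move: leN; rewrite ltnS; apply: leq_trans.
    by rewrite ltn_add2r ltn_subrL a_gt0 b_gt0.
  - by rewrite subn_gt0.
  - rewrite monE mulgA -rel expgMn // mulgA -expgnDr subnK 1?ltnW //.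
  exists s; first by rewrite sz !szp.
  apply: subset_trans sub; apply: spanP => //; first by case: (in2 x (x * y)).
  have [ix ixy] := in2 x (x * y); rewrite -[X in span _ X](mulKg x y).
  by apply: (subgroupM (sgp _ _)) => //; apply: (subgroupV (sgp _ _)).
have [|||s sz sub] := IH a (x * y) (p1 ++ ((b - a)%N, y) :: p2).
- rewrite sumE /=; move: leN; rewrite ltnS; apply: leq_trans.
  by rewrite ltn_add2l ltn_add2r ltn_subrL a_gt0 b_gt0.
- by [].
- by rewrite monE mulgA -rel expgMn // -(mulgA _ (y ^+ a)) -expgnDr subnKC.
exists s; first by rewrite sz !szp.
apply: subset_trans sub; have [ixy iy] := in2 (x * y) y; apply: spanP => //.
rewrite -[X in span _ X](mulgK y x); apply: (subgroupM (sgp _ _)) => //.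
by apply: (subgroupV (sgp _ _)).
Qed.

Lemma dependent_reduce s : ~ independent s ->
  exists2 s', (size s' < size s)%N & span s `<=` span s'.
Proof.
elim: s => [|x s IH] //= /not_andP[].
  case/existsNP=> k /not_implyP[/span_monomial[p [szp sub pE]] /eqP].
  rewrite -lt0n => k_gt0.
  (* The dependency [x ^+ k = monomial p] becomes a relation with natural exponents when [x] is
     inverted. *)
  have [|s' sz' sub'] := relation_reduce (x := x^-1) (p := p) k_gt0.
    by rewrite -pE expVgn mulVg.
  exists s'; first by rewrite sz' szp.
  apply: subset_trans sub'; apply: (span_sub (span_subgroup _)) => y.
  rewrite inE => /orP[/eqP ->|sy].
    rewrite -[X in span _ X]invgK; apply: (subgroupV (span_subgroup _)).
    by apply: mem_span; rewrite mem_head.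
  have sub2 : span (unzip2 p) `<=` span (x^-1 :: unzip2 p).
    by apply: span_subseq => t tp; rewrite inE tp orbT.
  exact: (sub2 _ (sub _ (mem_span sy))).
case/IH=> s' lts sub; exists (x :: s') => //.
apply: (span_sub (span_subgroup _)) => y; rewrite inE => /orP[/eqP ->|sy].
  by apply: mem_span; rewrite mem_head.
have sub2 : span s' `<=` span (x :: s').
  by apply: span_subseq => t tp; rewrite inE tp orbT.
exact: (sub2 _ (sub _ (mem_span sy))).
Qed.

Lemma independent_spanning s : span s = setT ->
  exists s', span s' = setT /\ independent s'.
Proof.
have [n] := ubnP (size s); elim: n s => // n IH s les spanT.
have [|/dependent_reduce[s' lts sub]] := pselect (independent s).
  by exists s.
apply: (IH s'); first exact: leq_trans lts _.
by apply/seteqP; split=> // x _; apply: sub; rewrite spanT.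
Qed.

End AbelianBasis.

(** * Images and preimages of subgroups under homomorphisms *)

Lemma image_subgroup (G H : groupType) (f : {hom G -> H}) (K : set G) :
  is_subgroup K -> is_subgroup (f @` K).
Proof.
move=> sK; apply: subgroup_intro.
- by exists 1; [exact: subgroup1 sK | exact: gmulf1].
- move=> _ _ [x Kx <-] [y Ky <-]; exists (x * y); last exact: gmulfM.
  exact: subgroupM sK _ _.
- move=> _ [x Kx <-]; exists x^-1; last exact: gmulfV.
  exact: subgroupV sK _.
Qed.

Lemma preimage_subgroup (G H : groupType) (f : {hom G -> H}) (K : set H) :
  is_subgroup K -> is_subgroup (f @^-1` K).
Proof.
move=> sK; apply: subgroup_intro; rewrite /preimage /=.
- by rewrite gmulf1; exact: subgroup1 sK.
- by move=> x y Kx Ky; rewrite gmulfM; exact: subgroupM sK _ _.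
- by move=> x Kx; rewrite gmulfV; exact: subgroupV sK _.
Qed.

(** * Structure of the completion: isolators of subgroups of [G] and coordinates *)

Section Completion.
Variables (pi : nat_pred) (G C : groupType) (i : {hom G -> C}).
Hypotheses (nilG : two_step_nilpotent G) (compl : is_pi_completion pi i).
Implicit Types (c d : C) (g h : G) (m n : nat).

Let inj_i : injective i. Proof. by case: compl. Qed.
Let nilC : nilpotent [set: C]. Proof. by case: compl. Qed.
Let compC : pi_complete pi [set: C]. Proof. by case: compl. Qed.
Let tfC : pi_torsion_free pi [set: C]. Proof. by case: compC. Qed.

(** Roots exist in [C], so a root-closed subgroup is [pi]-complete, and it inherits nilpotency;
    minimality then applies. *)
Lemma completion_minimal (H : set C) : is_subgroup H -> range i `<=` H ->
  (forall n c, pi.-nat n -> H (c ^+ n) -> H c) -> H = setT.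
Proof.
case: compl => _ _ _ min sH iH rootH; apply: min => //.
  exact: nilpotent_subgroup.
split=> [n a pin Ha|n x pin _]; last exact: tfC.
have [x _ xn] := compC.1 n a pin I.
by exists x => //; apply: (rootH n); rewrite // xn.
Qed.

Lemma derived_central g h : derived_subgroup G g -> commute g h.
Proof.
move=> Dg; apply/commgP/eqP.
have : commutator_subgroup (derived_subgroup G) setT [~ g, h].
  by apply: mem_generated; exists g, h.
by rewrite nilG.
Qed.

Lemma completion_two_step c d e : commute [~ c, d] e.
Proof.
apply: (commg_central nilC compC completion_minimal).
move=> _ _ _ [x _ <-] [y _ <-] [z _ <-].
by rewrite -gmulfR; apply/gmulf_commute/(derived_central _ (derived_comm _ _)).
Qed.

Let iso_subgroup := isolator_subgroup completion_two_step pi.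

Definition hull (K : set G) : set C := isolator pi (i @` K).

Lemma hull_subgroup K : is_subgroup K -> is_subgroup (hull K).
Proof. by move=> sK; apply/iso_subgroup/image_subgroup. Qed.

Lemma hull_mono K L : K `<=` L -> hull K `<=` hull L.
Proof. by move=> KL c [n pin [g Kg e]]; exists n => //; exists g; auto. Qed.

Lemma hull_setT c : hull setT c.
Proof.
have -> // : hull setT = setT; apply: completion_minimal.
- by apply: hull_subgroup; apply: subgroup_intro.
- by move=> d id; apply: isolator_ext.
- by move=> n d; apply: isolator_root_closed.
Qed.

(** If [c ^+ n] and [d ^+ m] lie in the image of [G], bilinearity puts [[~ c, d] ^+ (n * m)] in the
    image of the derived subgroup. *)
Lemma hull_comm c d : hull (isolator pi (derived_subgroup G)) [~ c, d].
Proof.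
have [n pin [g _ gE]] := hull_setT c; have [m pim [h _ hE]] := hull_setT d.
exists (n * m)%N; first by rewrite pnatM pin.
exists [~ g, h]; first exact: isolator_ext (derived_comm g h).
have comm3 := completion_two_step.
by rewrite expgnA -(commXg comm3) -(commgX comm3) -gE -hE gmulfR.
Qed.

Lemma hull_central c d :
  hull (isolator pi (derived_subgroup G)) c -> commute c d.
Proof.
move=> [n pin [g [m pim Dg] gE]].
apply: (centralizer_center (S := range i) nilC compC completion_minimal) => //.
move=> _ [h _ <-]; apply: (commute_root nilC tfC pin); rewrite -gE.
apply: (commute_root nilC tfC pim); rewrite -gmulfXn.
exact/gmulf_commute/(derived_central _ Dg).
Qed.

Lemma hull_root c n : pi.-nat n -> exists d, d ^+ n = c.
Proof. by move=> pin; have [d _ <-] := compC.1 n c pin I; exists d. Qed.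

Local Notation A := (quotient_group (isolator_derived G pi)).
Local Notation proj := (coset (isolator_derived G pi)).
Implicit Types (x : A) (s : seq A).

Lemma quotient_isolator_commute (a b : A) : commute a b.
Proof.
have [x ->] := coset_surj a; have [y ->] := coset_surj b.
apply/commgP/eqP; rewrite -gmulfR; apply/coset_eq1.
exact: isolator_ext (derived_comm x y).
Qed.

(** These subgroups increase with [s], from the central isolator of the derived subgroup at [[::]]
    to all of [C] when [s] spans. *)
Definition span_hull s : set C := hull (proj @^-1` span s).

Definition line_hull x : set C := hull (generated [set repr x]).

Lemma span_hull_subgroup s : is_subgroup (span_hull s).
Proof. exact/hull_subgroup/preimage_subgroup/span_subgroup. Qed.

Lemma line_hull_subgroup x : is_subgroup (line_hull x).
Proof. exact/hull_subgroup/generated_subgroup. Qed.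

Lemma line_hull_sub x s : x \in s -> line_hull x `<=` span_hull s.
Proof.
move=> sx; apply: hull_mono; apply: generated_sub.
  exact/preimage_subgroup/span_subgroup.
move=> _ ->; rewrite /preimage /= [proj _]reprK; exact: mem_span.
Qed.

Lemma line_hull_commute x c d : line_hull x c -> line_hull x d -> commute c d.
Proof.
move=> [n pin [g xg gE]] [m pim [h xh hE]].
apply: (commute_root nilC tfC pin); apply/commute_sym.
apply: (commute_root nilC tfC pim); rewrite -gE -hE; apply/gmulf_commute.
have [j gj] := generated1P xg; have [k hk] := generated1P xh.
have cxx p q : commute (repr x ^+ p) (repr x ^+ q).
  exact/commuteX2/commute_refl.
by case: gj hk => -> [] ->; do ?[exact: cxx | apply: commuteV | apply: commute_sym].
Qed.

Lemma span_hull_sub s s' : {subset s <= s'} -> span_hull s `<=` span_hull s'.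
Proof. by move=> sub; apply: hull_mono => g; apply: span_subseq. Qed.

Lemma span_hull_nil c d : span_hull [::] c -> commute c d.
Proof.
move=> Dc; apply: hull_central; apply: hull_mono Dc => g /=.
by move=> /span_nil /coset_eq1.
Qed.

Lemma span_hull_comm s c d : span_hull s [~ c, d].
Proof.
apply: hull_mono (hull_comm c d) => g /(coset_eq1 (isolator_derived G pi)) e.
by rewrite /preimage /= [proj _]e; exact: subgroup1 (span_subgroup _).
Qed.

Lemma span_hull_root s n c : pi.-nat n -> span_hull s (c ^+ n) -> span_hull s c.
Proof. exact: isolator_root_closed. Qed.

(** Existence of coordinates: one line factor is split off at a time. *)
Lemma span_hull_cons x s c : span_hull (x :: s) c ->
  exists u e, [/\ line_hull x u, span_hull s e & c = u * e].
Proof.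
move=> [n pin [g]]; rewrite /preimage /=.
case/(span_cons quotient_isolator_commute)=> [a [b [xa sb gab]]] gE.
have [a' xa' aE] : exists2 a', generated [set repr x] a' & proj a' = a.
  have /(_ a xa) [a' ? <-] : generated [set x] `<=` proj @` generated [set repr x].
    apply: generated_sub; first exact/image_subgroup/generated_subgroup.
    by move=> _ ->; exists (repr x); [exact: mem_generated | exact: reprK].
  by exists a'.
(* Up to a power of a commutator, which lies in every [span_hull], the [n]-th power of [u^-1 * c] is
   [i (a'^-1 * g)], and [a'^-1 * g] projects to [b] in [span s]. *)
have [u un] := hull_root (i a') pin; exists u, (u^-1 * c).
have xu : line_hull x u by exists n => //; exists a'.
split=> //; last by rewrite mulVKg.
apply: (span_hull_root pin).
have comm3 := completion_two_step.
rewrite (expMg_bin comm3); have sS := span_hull_subgroup s.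
apply: (subgroupM sS); last by apply: subgroupX => //; exact: span_hull_comm.
rewrite expVgn un -gE -gmulfV -gmulfM; apply: isolator_ext.
exists (a'^-1 * g) => //; rewrite /preimage /= gmulfM gmulfV /= aE gab mulKg.
exact: sb.
Qed.

(** Uniqueness of coordinates: a common [pi]-power of [u] would put a power of [x] in [span s]. *)
Lemma line_span_hull x s u : (forall k, span s (x ^+ k) -> k = 0%N) ->
  line_hull x u -> span_hull s u -> u = 1.
Proof.
move=> ind [m pim [h xh hE]] [n pin [g sg gE]].
have e : h ^+ n = g ^+ m by apply: inj_i; rewrite !gmulfXn hE gE expgnAC.
have [k hk] := generated1P xh.
have sV : span s (x ^+ (k * n)).
  have : span s (proj (h ^+ n)).
    by rewrite e gmulfXn; exact: subgroupX (span_subgroup s) sg.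
  have px : proj (repr x) = x by exact: reprK.
  case: hk => ->; first by rewrite !gmulfXn /= px expgnA.
  rewrite gmulfXn gmulfV gmulfXn /= px expVgn -expgnA.
  by move/(subgroupV (span_subgroup _)); rewrite invgK.
have /eqP := ind _ sV; rewrite muln_eq0 => /orP[/eqP k0|/eqP n0].
  by apply: (tfC pim) => //; rewrite -hE; case: hk => ->; rewrite k0 ?invg1 gmulf1.
by rewrite n0 in pin.
Qed.

(* The graph of an endomorphism of C that is u |-> u ^ m on the factors
   [line_hull x] and z |-> z ^ (m ^ 2) on the central factor [span_hull [::]]. *)
Fixpoint dilation m s c c' : Prop :=
  if s is x :: s' then exists u e e',
    [/\ line_hull x u, dilation m s' e e', c = u * e & c' = u ^+ m * e']
  else span_hull [::] c /\ c' = c ^+ (m * m).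

(** * Dilations as injective endomorphisms, handled through their graphs *)

Section Dilation.
Variable m : nat.

Lemma dilation_hull s c c' :
  dilation m s c c' -> span_hull s c /\ span_hull s c'.
Proof.
elim: s c c' => [|x s IH] c c' /=.
  by case=> Dc ->; split=> //; apply: subgroupX => //; exact: span_hull_subgroup.
case=> u [e [e' [xu /IH[se se'] -> ->]]].
have sS := span_hull_subgroup (x :: s).
have lx : span_hull (x :: s) u by apply: line_hull_sub xu; rewrite mem_head.
have sub : span_hull s `<=` span_hull (x :: s).
  by apply: span_hull_sub => y sy; rewrite inE sy orbT.
by split; apply: (subgroupM sS); [|exact: sub|apply: subgroupX|exact: sub].
Qed.

(** Each line factor contributes an [m]-th power and the central factor nothing. Dilating both
    arguments gives exponent [m * m], hence the exponent chosen on the central factor. *)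
Lemma dilation_comm s c c' d : dilation m s c c' -> [~ c', d] = [~ c, d] ^+ m.
Proof.
have comm3 := completion_two_step.
elim: s c c' => [|x s IH] c c' /=.
  case=> Dc ->; rewrite (commXg comm3).
  by have /commgP/eqP -> := span_hull_nil d Dc; rewrite !expg1n.
case=> u [e [e' [xu /IH ee' -> ->]]].
by rewrite !(commMg comm3) (commXg comm3) ee' -expgMn //; exact: comm3.
Qed.

Lemma dilation_central s c :
  span_hull [::] c -> dilation m s c (c ^+ (m * m)).
Proof.
move=> Dc; elim: s => [//|x s IH] /=; exists 1, c, (c ^+ (m * m)).
by split=> //; rewrite ?expg1n ?mul1g //; exact: subgroup1 (line_hull_subgroup x).
Qed.

Lemma dilationM s c c' d d' :
  dilation m s c c' -> dilation m s d d' -> dilation m s (c * d) (c' * d').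
Proof.
have comm3 := completion_two_step.
elim: s c c' d d' => [|x s IH] c c' d d' /=.
  case=> Dc -> [Dd ->]; split; first exact: subgroupM (span_hull_subgroup _) _ _.
  by rewrite expgMn //; exact: span_hull_nil.
case=> u [e [e' [xu ee' -> ->]]] [v [f [f' [xv ff' -> ->]]]].
(* Reordering [u * e * (v * f)] as [u * v * (e * [~ e, v] * f)] creates this central commutator, and
   the images reorder in the same way. *)
have ez : dilation m s [~ e, v] [~ e', v ^+ m].
  rewrite (dilation_comm _ ee') (commgX comm3) -expgnA.
  exact/dilation_central/span_hull_comm.
exists (u * v), (e * [~ e, v] * f), (e' * [~ e', v ^+ m] * f'); split.
- exact: subgroupM (line_hull_subgroup _) _ _.
- by apply: (IH) ff'; apply: IH.
- by rewrite mulgA -(mulgA u e) (commgC e v) !mulgA.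
- rewrite expgMn; last exact: line_hull_commute xu xv.
  by rewrite mulgA -(mulgA (u ^+ m) e') (commgC e' (v ^+ m)) !mulgA.
Qed.

Lemma dilationV s c c' : dilation m s c c' -> dilation m s c^-1 c'^-1.
Proof.
have comm3 := completion_two_step.
elim: s c c' => [|x s IH] c c' /=.
  case=> Dc ->; split; first exact: subgroupV (span_hull_subgroup _) _.
  by rewrite expVgn.
case=> u [e [e' [xu /IH ee' -> ->]]].
have ez : dilation m s [~ e^-1, u^-1] [~ e'^-1, u ^- m].
  rewrite (dilation_comm _ ee') -expVgn (commgX comm3) -expgnA.
  exact/dilation_central/span_hull_comm.
exists u^-1, (e^-1 * [~ e^-1, u^-1]), (e'^-1 * [~ e'^-1, u ^- m]); split.
- exact: subgroupV (line_hull_subgroup _) _.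
- exact: dilationM.
- by rewrite invgM (commgC e^-1); apply: esym; exact: mulgA.
- by rewrite invgM (commgC e'^-1) expVgn; apply: esym; exact: mulgA.
Qed.

Lemma dilation_eq1 s c c' : pi.-nat m -> independent s -> dilation m s c c' ->
  c = 1 <-> c' = 1.
Proof.
move=> pim; elim: s c c' => [|x s IH] c c' /=.
  move=> _ [_ ->]; split=> [->|]; first by rewrite expg1n.
  by apply: (tfC (n := (m * m)%N)) => //; rewrite pnatM pim.
case=> ind inds [u [e [e' [xu ee' -> ->]]]].
have [se se'] := dilation_hull ee'.
(* Independence makes the line factor meet the remaining factors trivially, so triviality can be
   tested coordinatewise. *)
have meet v f : line_hull x v -> span_hull s f -> v * f = 1 -> v = 1 /\ f = 1.
  move=> xv sf /mulg1_eq e1; suff v1 : v = 1 by rewrite -e1 v1 invg1.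
  apply: (line_span_hull ind) => //; rewrite -[v]invgK e1.
  exact: subgroupV (span_hull_subgroup _) _.
split=> /meet[] //.
- by move=> -> /(IH _ _ inds ee') ->; rewrite expg1n mul1g.
- by apply: subgroupX xu; exact: line_hull_subgroup.
- move=> um /(IH _ _ inds ee') ->; rewrite mulg1; exact: tfC um.
Qed.

End Dilation.

(** Allowing every multiple of [n] lets one [m] serve finitely many elements at once. *)
Lemma dilation_total s c : span_hull s c -> exists2 n, pi.-nat n &
  forall m, n %| m -> exists g, dilation m s c (i g).
Proof.
elim: s c => [|x s IH] c.
  move=> Dc; have [n pin [g Dg gE]] := Dc; exists n => // m /dvdnP[k ->].
  (* With [i g = c ^+ n] and [m = k * n], this is the exponent that yields [c ^+ (m * m)]. *)
  exists (g ^+ (k * (k * n))); split=> //.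
  by rewrite gmulfXn gE -expgnA; congr (c ^+ _); rewrite mulnCA mulnA.
case/span_hull_cons=> u [e [xu /IH[n pin ee'] ->]].
have [k pik [h xh hE]] := xu; exists (n * k)%N; first by rewrite pnatM pin.
move=> m nkm; have [g eg] := ee' m (dvdn_trans (dvdn_mulr _ (dvdnn n)) nkm).
have /dvdnP[q mE] : k %| m by exact: dvdn_trans (dvdn_mull _ (dvdnn k)) nkm.
exists (h ^+ q * g), u, e, (i g); split=> //.
by rewrite gmulfM gmulfXn hE -expgnA mE mulnC.
Qed.

End Completion.

(** * Generation of a free group by its basis *)

Section SubgroupType.
Variables (F : groupType) (H : set F).

Record subgroup_type (sH : is_subgroup H) :=
  SubgroupElt { subgroup_val : F; _ : subgroup_val \in H }.

Variable sH : is_subgroup H.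

HB.instance Definition _ := [isSub for @subgroup_val sH].
HB.instance Definition _ := [Choice of subgroup_type sH by <:].
HB.instance Definition _ :=
  SubChoice_isSubGroup.Build F (mem H) (subgroup_type sH) sH.

End SubgroupType.

(** The basis maps into [H], which gives a homomorphism from [F] to [H]; followed by the inclusion
    it fixes the basis, so by uniqueness it is the identity. *)
Lemma free_group_generated (X : Type) (F : groupType) (iota : X -> F)
    (H : set F) : is_free_group iota -> is_subgroup H ->
  (forall x, H (iota x)) -> H = setT.
Proof.
move=> freeF sH Hiota; pose K : groupType := subgroup_type sH.
have iotaH x : iota x \in H by exact/mem_set.
have [phi phiE _] := freeF K (fun x => SubgroupElt sH (iotaH x)).
pose incl : {hom K -> F} := (val : subgroup_type sH -> F).
have [psi _ uniq] := freeF F iota.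
apply/seteqP; split=> // w _; apply/set_mem.
have -> : w = incl (phi w); last exact: valP.
have <- : idfun w = w by [].
transitivity (psi w); first by apply: (uniq idfun).
apply/esym; apply: (uniq (incl \o phi)) => x /=.
by have /= -> := phiE x.
Qed.

(** * Comparison of the closures defined by [G] and by its completion *)

Theorem proposition3p10 (pi : nat_pred) (G C : groupType) (i : {hom G -> C})
  (pi_primes : forall p, p \in pi -> prime p)
  (pi_nonempty : exists p, p \in pi)
  (fgG : finitely_generated G)
  (tfG : pi_torsion_free pi [set: G]%classic)
  (nilG : two_step_nilpotent G)
  (tfQ : torsion_free (quotient_group (isolator_derived G pi)))
  (completionC : is_pi_completion pi i) :
  geometrically_equivalent G C.
Proof.
move=> X F iota freeF T; have [inj_i _ [_ tfC] _] := completionC.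
have [s0 gen0] := fgG.
have span0 : span (map (coset (isolator_derived G pi)) s0) = setT.
  apply/seteqP; split=> // a _; have [g ->] := coset_surj a.
  have : generated [set x | x \in s0] g by rewrite gen0.
  apply: (generated_sub (H := coset (isolator_derived G pi) @^-1`
    span (map (coset _) s0))); first exact/preimage_subgroup/span_subgroup.
  by move=> x s0x; apply: mem_span; apply: map_f.
have [s [spanT indep]] :=
  independent_spanning (@quotient_isolator_commute pi G) tfQ span0.
have total c : exists n, pi.-nat n /\
    forall m, n %| m -> exists g, dilation i m s c (i g).
  have sc : span_hull i s c.
    rewrite /span_hull spanT preimage_setT; exact: hull_setT nilG completionC c.
  by have [n pin nP] := dilation_total nilG completionC sc; exists n.
have [mu muP] := choice total.
apply/seteqP; split=> w Tw phi Tphi; last first.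
  (* The easy inclusion: a homomorphism to [G] followed by the embedding keeps its kernel. *)
  apply: inj_i; rewrite gmulf1; apply: (Tw (i \o phi)) => t /Tphi phit.
  by rewrite /ker /= phit gmulf1.
pose m := (\prod_(x : X) mu (phi (iota x)))%N.
have pim : pi.-nat m.
  apply: (big_ind (fun n => pi.-nat n)) => // [a b pia pib|x _].
    by rewrite pnatM pia.
  by case: (muP (phi (iota x))).
have lands x : exists g, dilation i m s (phi (iota x)) (i g).
  by apply: (muP _).2; rewrite /m (bigD1 x) //= dvdn_mulr.
have [f fP] := choice lands; have [psi psiE _] := freeF G f.
(* [psi] is the dilation of [phi] on the basis; the words on which this persists form a subgroup,
   hence all of [F]. *)
have graph : [set v | dilation i m s (phi v) (i (psi v))] = setT.
  apply: (free_group_generated freeF) => [|x /=]; last first.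
    by have /= -> := psiE x.
  apply: subgroup_intro => [|u v /= du dv|u /= du].
  - have := dilation_central nilG completionC m s
      (subgroup1 (span_hull_subgroup nilG completionC [::])).
    by rewrite /= expg1n !gmulf1.
  - by rewrite !gmulfM; apply: dilationM.
  - by rewrite !gmulfV; apply: dilationV.
have eq1 v : phi v = 1 <-> psi v = 1.
  have dv : dilation i m s (phi v) (i (psi v)).
    by have : setT v by []; rewrite -graph.
  rewrite (dilation_eq1 nilG completionC pim indep dv); split=> [e|->].
    by apply: inj_i; rewrite e gmulf1.
  exact: gmulf1.
by apply/eq1; apply: (Tw psi) => t Tt; apply/eq1/Tphi.
Qed.
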